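(* Let $(X,\mathcal{A},\mu)$ be a measure space and let $I$ be an ideal of the ring $\mathcal{M}(X,\mathcal{A})$. The following statements are equivalent. (1) $L_I^\infty(\mu)=\mathcal{M}(X,\mathcal{A})$. (2) $I\mu(X,\mathcal{A})=\mathcal{M}(X,\mathcal{A})$. (3) The pseudonorm topology on $L_I^\infty(\mu)$ is identical to the relative $m_{\mu_I}$-topology on it (i.e. the subspace topology inherited from $\mathcal{M}(X,\mathcal{A})$ with the $m_{\mu_I}$-topology). (4) The $m_{\mu_I}$-topology on $\mathcal{M}(X,\mathcal{A})$ is connected. (5) The $m_{\mu_I}$-topology on $\mathcal{M}(X,\mathcal{A})$ is locally connected. (6) $Z[I]$ is a $\mu$-stable set, in the sense that given $f\in\mathcal{M}(X,\mathcal{A})$ there exist $Z\in Z[I]$ and $E\subseteq Z$ with $\mu(E)=0$ such that $f$ is bounded on $Z\setminus E$. (7) $\mathcal{M}(X,\mathcal{A})$ with the $m_{\mu_I}$-topology is a topological vector space.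
   Context: $X$ is a non-empty set, $\mathcal{A}$ a $\sigma$-algebra on $X$, and $\mu:\mathcal{A}\to[0,\infty]$ a measure. $\mathcal{M}(X,\mathcal{A})$ is the commutative ring with unity (and real vector space) of all real-valued $\mathcal{A}$-measurable functions on $X$, with pointwise operations. For $g\in\mathcal{M}(X,\mathcal{A})$, $Z(g)=\{x\in X: g(x)=0\}$, and for an ideal $I$, $Z[I]=\{Z(g): g\in I\}$. Null sets $E$ are always members of $\mathcal{A}$. A function $f\in\mathcal{M}(X,\mathcal{A})$ is essentially $I$-bounded on $X$ if there exist $Z\in Z[I]$, $E\subseteq Z$ with $\mu(E)=0$, and a real number $\lambda>0$ such that $|f(x)|\le\lambda$ for all $x\in Z\setminus E$; any such $\lambda$ is called an essential $I$-upper bound of $f$ over $X$. $L_I^\infty(\mu)$ is the set of all essentially $I$-bounded functions in $\mathcal{M}(X,\mathcal{A})$. For $f\in L_I^\infty(\mu)$, $\|f\|_I^\infty$ is the infimum of the set of all essential $I$-upper bounds of $f$; it is a pseudonorm (seminorm) on the vector space $L_I^\infty(\mu)$, and the pseudonorm topology is the one induced by the pseudometric $(f,g)\mapsto\|f-g\|_I^\infty$. $I\mu(X,\mathcal{A})$ is the set of all $f\in\mathcal{M}(X,\mathcal{A})$ such that for every $g\in\mathcal{M}(X,\mathcal{A})$ there exist $Z\in Z[I]$ and $E\subseteq Z$ with $\mu(E)=0$ such that $fg$ is bounded on $Z\setminus E$. $U_{\mu_I}^+$ is the set of all $u\in\mathcal{M}(X,\mathcal{A})$ for which there exist $Z\in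 Z[I]$ and $E\subseteq Z$ with $\mu(E)=0$ such that $u(x)>0$ for all $x\in Z\setminus E$. For $f\in\mathcal{M}(X,\mathcal{A})$ and $u\in U_{\mu_I}^+$, $m_{\mu_I}(f,u)$ is the set of all $g\in\mathcal{M}(X,\mathcal{A})$ for which there exist $Z\in Z[I]$ and $E\subseteq Z$ with $\mu(E)=0$ such that $|g(x)-f(x)|<u(x)$ for all $x\in Z\setminus E$. The sets $m_{\mu_I}(f,u)$ ($f\in\mathcal{M}(X,\mathcal{A})$, $u\in U_{\mu_I}^+$) form an open base for a topology on $\mathcal{M}(X,\mathcal{A})$, called the $m_{\mu_I}$-topology. Topological vector spaces (over $\mathbb{R}$) are not required to be Hausdorff. *)

(* Defs.v *)
From HB Require Import structures.
From mathcomp Require Import all_boot all_order all_algebra.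
From mathcomp Require Import all_classical all_reals all_analysis.
From mathcomp Require Import measurable_realfun.

Set Implicit Arguments.
Unset Strict Implicit.
Unset Printing Implicit Defensive.

Import Order.TTheory GRing.Theory Num.Theory.
Import numFieldNormedType.Exports.

Local Open Scope classical_set_scope.
Local Open Scope ring_scope.

(* Ideals need not be proper (unlike [idealr]), and are arbitrary
   classical subsets. *)
Definition is_ideal (A : comNzRingType) (J : set A) : Prop :=
  [/\ J 0, (forall f g, J f -> J g -> J (f + g))
    & (forall a f, J f -> J (a * f))].

Record ideal (A : comNzRingType) := Ideal {
  ideal_set :> set A;
  ideal_setP : is_ideal ideal_set }.

Definition topology_of (X : topologicalType) : set (set X) := open.
Arguments topology_of X : clear implicits.

Definition locally_connected (X : topologicalType) : Prop :=
  forall (x : X) (U : set X), nbhs x U ->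
    exists V : set X, [/\ open V, V x, connected V & V `<=` U].

(* A vector space with a topology is a topological vector space (no Hausdorff
   axiom, no local convexity) when both operations are jointly continuous. *)
Definition is_tvs (R : realType) (V : preTopologicalLmodType R) : Prop :=
  continuous (fun z : V * V => z.1 + z.2) /\
  continuous (fun z : R^o * V => z.1 *: z.2).

(* [measurableType]s are pointed, hence non-empty. *)
Section definitions.
Context {d : measure_display} {T : measurableType d} {R : realType}.
Variable mu : {measure set T -> \bar R}.
Implicit Types (f g u : {mfun T >-> R}) (S : set (set T)).

Definition zero_set g : set T := [set x | g x = 0].

(* P (Z \ E) for some Z in S and some null set E included in Z *)
Definition holds_off_null S (P : set T -> Prop) : Prop :=
  exists Z E : set T,
    [/\ S Z, E `<=` Z, measurable E, mu E = 0%E & P (Z `\` E)].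

Definition mu_stable S : Prop :=
  forall f, holds_off_null S (fun D => [bounded f x | x in D]).

Variable I : set {mfun T >-> R}.

Definition zero_sets : set (set T) := [set zero_set g | g in I].

Definition ess_upper_bound f (l : R) : Prop :=
  0 < l /\ holds_off_null zero_sets (fun D => forall x, D x -> `|f x| <= l).

Definition Linfty : set {mfun T >-> R} :=
  [set f | exists l, ess_upper_bound f l].

(* Only meaningful on [Linfty], where the set is nonempty. *)
Definition Linfty_norm f : R := inf [set l | ess_upper_bound f l].

Definition Imu : set {mfun T >-> R} :=
  [set f | forall g,
    holds_off_null zero_sets (fun D => [bounded f x * g x | x in D])].

Definition Upos : set {mfun T >-> R} :=
  [set u | holds_off_null zero_sets (fun D => forall x, D x -> 0 < u x)].

Definition m_nbhd f u : set {mfun T >-> R} :=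
  [set g | holds_off_null zero_sets
             (fun D => forall x, D x -> `|g x - f x| < u x)].

Definition m_base : set (set {mfun T >-> R}) :=
  [set B | exists f, exists2 u, Upos u & B = m_nbhd f u].

End definitions.

Section ideal_facts.
Context {d : measure_display} {T : measurableType d} {R : realType}.
Variables (mu : {measure set T -> \bar R}) (I : ideal {mfun T >-> R}).
Implicit Types (f g u : {mfun T >-> R}).

Local Notation off_null := (holds_off_null mu (zero_sets I)).

Lemma zero_setsI (Z1 Z2 : set T) :
  zero_sets I Z1 -> zero_sets I Z2 -> zero_sets I (Z1 `&` Z2).
Proof.
have [_ ID IM] := ideal_setP I.
move=> [f If <-] [g Ig <-]; exists (f * f + g * g).
  by apply: ID; apply: IM.
apply/seteqP; split => x; rewrite /zero_set /=.
  rewrite -[LHS]/(f x * f x + g x * g x) => /eqP.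
  rewrite -!expr2 paddr_eq0 ?sqr_ge0// !sqrf_eq0.
  by move=> /andP[/eqP ? /eqP ?].
move=> [fx gx]; rewrite -[LHS]/(f x * f x + g x * g x).
by rewrite fx gx mulr0 addr0.
Qed.

Lemma off_null_setT (Q : T -> Prop) : (forall x, Q x) ->
  off_null (fun D => forall x, D x -> Q x).
Proof.
have [I0 _ _] := ideal_setP I.
move=> HQ; exists (zero_set (0 : {mfun T >-> R})), set0.
by split => //; exists 0.
Qed.

Lemma off_null_impl2 (Q1 Q2 Q3 : T -> Prop) :
  (forall x, Q1 x -> Q2 x -> Q3 x) ->
  off_null (fun D => forall x, D x -> Q1 x) ->
  off_null (fun D => forall x, D x -> Q2 x) ->
  off_null (fun D => forall x, D x -> Q3 x).
Proof.
move=> Q123 [Z1 [E1 [SZ1 EZ1 mE1 E10 H1]]] [Z2 [E2 [SZ2 EZ2 mE2 E20 H2]]].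
have mZ Z : zero_sets I Z -> measurable Z.
  move=> [g _ <-]; rewrite /zero_set -[X in measurable X]setTI.
  exact: (measurable_funP g measurableT [set 0] (measurable_set1 0)).
exists (Z1 `&` Z2), ((Z1 `&` Z2) `&` (E1 `|` E2)); split.
- exact: zero_setsI.
- exact: subIsetl.
- by apply: measurableI; [apply: measurableI; exact: mZ|exact: measurableU].
- have E12 : mu (E1 `|` E2) = 0%E.
    by apply/eqP; rewrite measureU0// E10.
  apply: subset_measure0 E12 => //; last exact: measurableU.
  by apply: measurableI; [apply: measurableI; exact: mZ|exact: measurableU].
- move=> x [[Z1x Z2x] nE]; apply: Q123.
  + by apply: H1; split => // E1x; apply: nE; split => //; left.
  + by apply: H2; split => // E2x; apply: nE; split => //; right.
Qed.

Lemma off_null_impl (Q1 Q2 : T -> Prop) : (forall x, Q1 x -> Q2 x) ->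
  off_null (fun D => forall x, D x -> Q1 x) ->
  off_null (fun D => forall x, D x -> Q2 x).
Proof. by move=> Q12 H; apply: (off_null_impl2 _ H H) => x /Q12. Qed.

Lemma m_base_cover : \bigcup_(B in m_base mu I) B = setT.
Proof.
apply/seteqP; split => // f _; exists (m_nbhd mu I f 1).
  by exists f, 1 => //; apply: off_null_setT => x; exact: ltr01.
by apply: off_null_setT => x; rewrite subrr normr0 ltr01.
Qed.

Lemma m_base_join (A B : set {mfun T >-> R}) h :
  m_base mu I A -> m_base mu I B -> A h -> B h ->
  exists C, [/\ m_base mu I C, C h & C `<=` A `&` B].
Proof.
move=> [f [u Uu ->]] [g [v Uv ->]] hA hB.
pose wf : T -> R := (u \- (Num.norm \o (h \- f))) \min (v \- (Num.norm \o (h \- g))).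
have mwf : measurable_fun setT wf.
  by apply: measurable_minr; apply: measurable_funB => //;
    apply: measurableT_comp => //; exact: measurable_funB.
pose w : {mfun T >-> R} :=
  HB.pack_for {mfun T >-> R} wf (isMeasurableFun.Build _ _ _ _ wf mwf).
have wE x : w x = Num.min (u x - `|h x - f x|) (v x - `|h x - g x|) by [].
exists (m_nbhd mu I h w); split.
- exists h, w => //; apply: off_null_impl2 hA hB => x.
  by rewrite wE lt_min !subr_gt0 => -> ->.
- apply: off_null_impl2 hA hB => x.
  by rewrite wE subrr normr0 lt_min !subr_gt0 => -> ->.
- move=> k hk; split.
  + apply: off_null_impl hk => x; rewrite wE lt_min => /andP[+ _].
    by rewrite ltrBrDr; apply: le_lt_trans; exact: ler_distD.
  + apply: off_null_impl hk => x; rewrite wE lt_min => /andP[_].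
    by rewrite ltrBrDr; apply: le_lt_trans; exact: ler_distD.
Qed.

Lemma Linfty_normP f (e : R) : Linfty mu I f ->
  Linfty_norm mu I f < e <-> exists2 l, ess_upper_bound mu I f l & l < e.
Proof.
move=> Lf; have lb : has_lbound [set l | ess_upper_bound mu I f l].
  by exists 0 => l [/ltW].
split=> [|[l fl]]; last by apply: le_lt_trans; exact: ge_inf.
by move=> /inf_lt[]// l fl le; exists l.
Qed.

Lemma LinftyB f g : Linfty mu I f -> Linfty mu I g -> Linfty mu I (f - g).
Proof.
move=> [l [l0 fl]] [m [m0 gm]]; exists (l + m); split; first exact: addr_gt0.
apply: off_null_impl2 fl gm => x fx gx.
by apply: le_trans (ler_normB _ _) _; exact: lerD.
Qed.

End ideal_facts.

(* The vector space of all measurable functions, with the topology that has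
   the sets m(f, u) as an open base; [mu] and [I] are only used to select that
   topology. *)
Definition m_space (d : measure_display) (T : measurableType d) (R : realType)
  (mu : {measure set T -> \bar R}) (I : ideal {mfun T >-> R}) : Type :=
  {mfun T >-> R}.

Section m_space_topology.
Context {d : measure_display} {T : measurableType d} {R : realType}.
Variables (mu : {measure set T -> \bar R}) (I : ideal {mfun T >-> R}).

HB.instance Definition _ := GRing.Lmodule.on (m_space mu I).
HB.instance Definition _ := @isBaseTopological.Build (m_space mu I)
  (set {mfun T >-> R}) (m_base mu I) id
  (m_base_cover mu I) (@m_base_join _ _ _ mu I).

End m_space_topology.

Section pseudonorm_space.
Context {d : measure_display} {T : measurableType d} {R : realType}.
Variables (mu : {measure set T -> \bar R}) (I : ideal {mfun T >-> R}).

(* The set [Linfty mu I], as a type, with the pseudonorm topology *)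
Definition Linfty_space : Type := set_type (Linfty mu I).

HB.instance Definition _ := Choice.on Linfty_space.

Definition Linfty_ball (f : Linfty_space) (e : R) (g : Linfty_space) : Prop :=
  Linfty_norm mu I (\val f - \val g) < e.

Let LB (f g : Linfty_space) : Linfty mu I (\val f - \val g).
Proof. by apply: LinftyB; exact: set_valP. Qed.

Let ball_center f (e : R) : 0 < e -> Linfty_ball f e f.
Proof.
move=> e0; apply/Linfty_normP; first exact: LB.
exists (e / 2); last by rewrite gtr_pMr// invf_lt1// ltr1n.
split; first exact: divr_gt0.
by apply: off_null_setT => x; rewrite subrr normr0 divr_ge0// ltW.
Qed.

Let ball_sym f g (e : R) : Linfty_ball f e g -> Linfty_ball g e f.
Proof.
move=> /(Linfty_normP _ (LB _ _))[l [l0 fgl] le].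
apply/(Linfty_normP _ (LB _ _)); exists l => //; split => //.
by apply: off_null_impl fgl => x; rewrite distrC.
Qed.

Let ball_triangle f g h (e1 e2 : R) :
  Linfty_ball f e1 g -> Linfty_ball g e2 h -> Linfty_ball f (e1 + e2) h.
Proof.
move=> /(Linfty_normP _ (LB _ _))[l [l0 fgl] le].
move=> /(Linfty_normP _ (LB _ _))[m [m0 ghm] me].
apply/(Linfty_normP _ (LB _ _)); exists (l + m); last exact: ltrD.
split; first exact: addr_gt0.
apply: off_null_impl2 fgl ghm => x fg gh.
by apply: le_trans (ler_distD (\val g x) _ _) _; exact: lerD.
Qed.

HB.instance Definition _ := hasNbhs.Build Linfty_space
  (nbhs_ (entourage_ Linfty_ball)).
HB.instance Definition _ := @Nbhs_isPseudoMetric.Build R Linfty_space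
  (entourage_ Linfty_ball) erefl Linfty_ball ball_center ball_sym
  ball_triangle erefl.

End pseudonorm_space.

(* The same type with the relative topology: the canonical topology of
   [set_type A], for [A : set X], is induced by the inclusion into [X]. *)
Definition Linfty_subspace (d : measure_display) (T : measurableType d)
    (R : realType) (mu : {measure set T -> \bar R})
    (I : ideal {mfun T >-> R}) : Type :=
  set_type (Linfty mu I : set (m_space mu I)).

HB.instance Definition _ (d : measure_display) (T : measurableType d)
    (R : realType) (mu : {measure set T -> \bar R})
    (I : ideal {mfun T >-> R}) :=
  Topological.on (Linfty_subspace mu I).

(* Main.v *)
Require Import Defs.
From HB Require Import structures.
From mathcomp Require Import all_boot all_order all_algebra.
From mathcomp Require Import all_classical all_reals all_analysis.
From mathcomp Require Import measurable_realfun.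

Set Implicit Arguments.
Unset Strict Implicit.
Unset Printing Implicit Defensive.

Import Order.TTheory GRing.Theory Num.Theory.
Import numFieldNormedType.Exports.

Local Open Scope classical_set_scope.
Local Open Scope ring_scope.

(** The sets containing Z \ E, for a zero set Z of a member of I and a null set
    E included in Z, form a filter on T ([conull]). Every notion in the theorem
    is a statement about this filter: f is essentially I-bounded iff |f| <= l
    eventually for some l, u is in U+ iff u > 0 eventually, and the neighborhood
    m(f, u) is the set of the g with |g - f| < u eventually. The filter need not
    be proper; when it is not, all seven statements hold.

    All the statements are compared with (1), that every measurable function is
    essentially bounded. Statements (6) and (2) are rephrasings of it: take the
    product with 1 in one direction, apply stability to a product in the other.

    The remaining equivalences rest on three observations.

    - Inverting a positive function exchanges upper bounds and lower bounds, so
      (1) holds iff every u in U+ is eventually at least some constant e > 0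
      ([Linfty_setT_Upos]). The latter says that neighborhoods with variable
      radius u contain neighborhoods with constant radius e, which is (3), and
      it is also what makes scalar multiplication continuous; addition always
      is. Conversely, if t f tends to 0 with t, then |t f| < 1 eventually for
      some t > 0 and f is essentially bounded, so (7) implies (1).

    - In a topological vector space, a set that is star-shaped about a point is
      connected, being a union of segments through it ([star_connected]). The
      whole space and the sets m(f, u) are star-shaped, so (7) implies (4) and
      (5).

    - For p in U+, the functions h that satisfy |h| <= l p eventually for some
      l form a clopen set, because moving h by less than p only changes l into
      l + 1. A connected set containing 0 is therefore included in all of these
      sets ([connected_dominated]). With p = 1 this shows that (4) implies (1).
      If a connected set is a neighborhood of 0, it contains u / 2 for some u in
      U+, so u / 2 <= l p eventually for every p, with l depending on p; the
      choice p = u / (1 + |f|) bounds f, so (5) implies (1). *)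

(** * Essential boundedness along a filter *)

Lemma bounded_onP (T : Type) (R : realType) (f : T -> R) (D : set T) :
  [bounded f x | x in D] <-> exists l, forall x, D x -> `|f x| <= l.
Proof.
split=> [[l [_ fl]]|[l fl]]; first by exists (l + 1); apply: fl; rewrite ltrDl.
exists l; split; first exact: num_real.
by move=> m lm x /fl /le_trans; apply; exact: ltW.
Qed.

Section near_zero_sets.
Context {d : measure_display} {T : measurableType d} {R : realType}.
Variables (mu : {measure set T -> \bar R}) (I : ideal {mfun T >-> R}).
Implicit Types (f g h u p : {mfun T >-> R}).

(** Membership in this filter unfolds to the predicates that define [Upos] and
    [m_nbhd], so a proof of one is a proof of the other. *)
Definition conull : set_system T :=
  fun Q => holds_off_null mu (zero_sets I) (fun D => D `<=` Q).

#[global] Instance conull_filter : Filter conull.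
Proof.
split; first by apply: off_null_setT => x.
- by move=> P Q; apply: off_null_impl2 => x.
- by move=> P Q PQ; apply: off_null_impl.
Qed.

Local Notation "'\ae' x , P" := (conull (fun x => P))
  (at level 200, x name, P at level 200).

Local Notation aeS := (@filterS _ conull _ _ _ _).
Local Notation aeS2 := (@filterS2 _ conull _ _ _ _ _).
Local Notation aeS3 := (@filterS3 _ conull _ _ _ _ _ _).

Lemma holds_off_null_bounded f :
  holds_off_null mu (zero_sets I) (fun D => [bounded f x | x in D]) <->
  exists l, \ae x, `|f x| <= l.
Proof.
split=> [[Z [E [SZ EZ mE E0 /bounded_onP[l fl]]]]|[l [Z [E [SZ EZ mE E0 fl]]]]].
  by exists l, Z, E.
by exists Z, E; split=> //; apply/bounded_onP; exists l.
Qed.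

(** The principal order ideal generated by p, up to eventual inequality; the
    case p = 1 is the space of essentially bounded functions. *)
Definition dominated p : set {mfun T >-> R} :=
  [set h | exists l, \ae x, `|h x| <= l * p x].

Lemma LinftyE f : Linfty mu I f <-> dominated 1 f.
Proof.
split=> [[l [_ fl]]|[l fl]].
  by exists l; apply: (aeS fl) => x; rewrite mulr1.
(* an essential upper bound has to be positive, which l need not be *)
exists (`|l| + 1); split; first by rewrite ltr_wpDl.
apply: (aeS fl) => x /le_trans; apply.
by rewrite mulr1; apply: le_trans (ler_norm l) _; rewrite lerDl.
Qed.

(** The power function with exponent -1 is measurable and agrees with the
    inverse on nonnegative reals. *)
Lemma mfun_inv u : exists v : {mfun T >-> R}, forall x, 0 < u x -> v x = (u x)^-1.
Proof.
pose v x := u x `^ (-1); have mv : measurable_fun setT v.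
  exact: (measurableT_comp (measurable_powR _)) (measurable_funPT u).
exists (HB.pack_for {mfun T >-> R} v (isMeasurableFun.Build _ _ _ _ v mv)).
by move=> x /ltW; exact: powR_inv1.
Qed.

(** A positive function p so much smaller than u that u can be at most a
    multiple of p only where f is bounded. *)
Lemma mfun_div f u : Upos mu I u ->
  exists2 p, Upos mu I p & forall x, p x * (1 + `|f x|) = u x.
Proof.
pose w : {mfun T >-> R} := 1 + (Num.norm \o f : {mfun T >-> R}).
have w0 x : 0 < w x by apply: ltr_pwDl; [exact: ltr01|exact: normr_ge0].
have [v vE] := mfun_inv w => Uu.
have vw x : v x * (1 + `|f x|) = 1 by rewrite vE// mulVf// gt_eqF.
exists (u * v) => [|x].
  apply: (aeS Uu) => x ux.
  by rewrite -[X in 0 < X]/(u x * v x) vE// divr_gt0.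
by rewrite -[LHS]/(u x * v x * _) -mulrA vw mulr1.
Qed.

(** An upper bound of 1 / u is the inverse of a lower bound of u; conversely a
    lower bound of 1 / (1 + |f|) gives an upper bound of f. *)
Lemma Linfty_setT_Upos : Linfty mu I = setT <->
  forall u, Upos mu I u -> exists2 e, 0 < e & \ae x, e <= u x.
Proof.
split=> [LT u Uu|ULB].
  have [v vE] := mfun_inv u.
  have [l [l0 vl]] : Linfty mu I v by rewrite LT.
  exists l^-1; first by rewrite invr_gt0.
  apply: (aeS2 Uu vl) => x ux.
  by rewrite vE// gtr0_norm ?invr_gt0// -[X in _ -> _ <= X]invrK lef_pV2// posrE invr_gt0.
apply/seteqP; split=> // f _; apply/LinftyE.
have U1 : Upos mu I 1 by apply: off_null_setT => x; exact: ltr01.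
have [p Up pE] := mfun_div f U1; have [e e0 pe] := ULB p Up.
exists e^-1; apply: (aeS pe) => x ex.
rewrite mulr1 -[e^-1]mul1r ler_pdivlMr// -[leRHS](pE x) mulrC.
apply: ler_pM => //; first exact: ltW.
by rewrite lerDr.
Qed.

(** * The m-topology *)

Local Notation M := (m_space mu I).

(** A point f of m(g, v) is the center of the smaller neighborhood with radius
    v - |f - g|. *)
Lemma m_nbhsP (f : M) (U : set M) :
  nbhs f U <-> exists2 u, Upos mu I u & m_nbhd mu I f u `<=` U.
Proof.
split=> [|[u Uu uU]]; last first.
  rewrite nbhsE; exists (m_nbhd mu I f u) => //; split.
    exists [set m_nbhd mu I f u]; first by move=> _ ->; exists f, u.
    by rewrite bigcup_set1.
  by apply: (aeS Uu) => x; rewrite subrr normr0.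
rewrite nbhsE => -[B [[D' D'b <-] [A D'A Af]] BU].
have [g [v Uv AE]] := D'b _ D'A; rewrite /= AE in Af.
exists (v - (Num.norm \o ((f : {mfun T >-> R}) - g) : {mfun T >-> R})).
  by apply: (aeS Af) => x; rewrite -subr_gt0.
move=> h fh; apply: BU; exists A => //; rewrite /= AE.
apply: (aeS fh) => x; rewrite [X in _ < X -> _]/= -[X in _ < X]/(v x - `|f x - g x|).
by rewrite ltrBrDr; apply: le_lt_trans; exact: ler_distD.
Qed.

Lemma open_m_nbhd f u : Upos mu I u -> open (m_nbhd mu I f u : set M).
Proof.
move=> Uu; exists [set m_nbhd mu I f u]; last by rewrite bigcup_set1.
by move=> _ ->; exists f, u.
Qed.

Lemma m_nbhd_refl f u : Upos mu I u -> m_nbhd mu I f u f.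
Proof. by move=> Uu; apply: (aeS Uu) => x; rewrite subrr normr0. Qed.

Lemma m_add_continuous : continuous (fun z : M * M => z.1 + z.2).
Proof.
move=> [f g] W /m_nbhsP[u Uu uW].
pose v : {mfun T >-> R} := 2^-1 *: u.
have vE x : v x = u x / 2 by rewrite mulrC.
have Uv : Upos mu I v.
  by apply: (aeS Uu) => x ux; rewrite vE divr_gt0.
exists (m_nbhd mu I f v, m_nbhd mu I g v).
  by split; apply/m_nbhsP; exists v.
move=> [f' g'] [/= ff' gg']; apply: uW.
apply: (aeS2 ff' gg') => x; rewrite vE => fx gx.
rewrite -[X in `|X|]/((f' x + g' x) - (f x + g x)) opprD addrACA.
by apply: le_lt_trans (ler_normD _ _) _; rewrite [u x]splitr ltrD.
Qed.

(** By [Linfty_setT_Upos] a constant radius e suffices around a f. There the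
    usual estimate with b g - a f = (b - a) g + a (g - f) applies, since f is
    essentially bounded. *)
Lemma m_scale_continuous : Linfty mu I = setT ->
  continuous (fun z : R^o * M => z.1 *: z.2).
Proof.
move=> LT [a f] W /m_nbhsP[u Uu uW].
have [e e0 ue] := (Linfty_setT_Upos.1 LT) u Uu.
have [l [l0 fl]] : Linfty mu I f by rewrite LT.
(* for |b - a| <= r, |g - f| <= r and r <= 1, the distance is at most
   r (1 + l) + |a| r, which is smaller than r k *)
pose k : R := l + `|a| + 2; have k0 : 0 < k.
  by rewrite /k -addrA ltr_pwDl// addr_ge0.
pose r := Num.min 1 (e / k).
have r0 : 0 < r by rewrite lt_min ltr01 divr_gt0.
have Ur : Upos mu I (cst r) by apply: off_null_setT.
exists (ball (a : R^o) r, m_nbhd mu I f (cst r)).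
  split; first exact: nbhsx_ballx.
  by apply/m_nbhsP; exists (cst r).
move=> [b g] [/= ab fg]; apply: uW.
apply: (aeS3 ue fl fg) => x uex flx fgx.
apply: lt_le_trans uex.
rewrite -[X in `|X|]/(b * g x - a * f x).
have -> : b * g x - a * f x = (b - a) * ((g x - f x) + f x) + a * (g x - f x).
  by rewrite subrK mulrBl mulrBr addrA subrK.
have rk : r * k <= e by rewrite -ler_pdivlMr// ge_min lexx orbT.
have r1 : r <= 1 by rewrite ge_min lexx.
have abr : `|b - a| <= r by rewrite distrC ltW.
have fgr : `|g x - f x| <= r by rewrite ltW.
apply: le_lt_trans (ler_normD _ _) _; rewrite !normrM.
apply: le_lt_trans (_ : r * (1 + l) + `|a| * r < _).
  apply: lerD; last by rewrite ler_wpM2l.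
  apply: ler_pM => //; apply: le_trans (ler_normD _ _) _; apply: lerD => //.
  exact: le_trans r1.
apply: lt_le_trans rk; rewrite [`|a| * r]mulrC -mulrDr ltr_pM2l// /k.
by rewrite -addrA [1 + _]addrC ltrD2l ltr1n.
Qed.

(** If scalar multiplication is continuous at (0, f), some t > 0 brings t f into
    m(0, 1), so that |f| < 1 / t eventually. *)
Lemma is_tvs_m_space : Linfty mu I = setT <-> is_tvs (m_space mu I).
Proof.
split=> [LT|[_ scal]].
  by split; [exact: m_add_continuous|exact: m_scale_continuous].
apply/seteqP; split=> // f _; apply/LinftyE.
have U1 : Upos mu I 1 by apply: off_null_setT => x; exact: ltr01.
have : nbhs (0 *: (f : M)) (m_nbhd mu I (0 : {mfun T >-> R}) 1).
  by rewrite scale0r; apply/m_nbhsP; exists 1.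
move=> /(scal ((0 : R^o), (f : M)))[[P Q] /= [/nbhs_ballP[e /= e0 eP] Qf] PQ].
have /PQ : (P `*` Q) ((e / 2 : R^o), (f : M)).
  split=> /=; last exact: (nbhs_singleton Qf).
  apply: eP; rewrite /ball/= sub0r normrN gtr0_norm ?divr_gt0//.
  by rewrite ltr_pdivrMr// ltr_pMr// ltr1n.
move=> fe; exists (e / 2)^-1; apply: (aeS fe) => x.
rewrite -[X in `|X|]/(e / 2 * f x - 0) subr0 normrM gtr0_norm ?divr_gt0// => ex.
by rewrite mulr1 -[leRHS]mul1r ler_pdivlMr ?divr_gt0// mulrC ltW.
Qed.

Lemma m_nbhd_sym f p h : m_nbhd mu I f p h -> m_nbhd mu I h p f.
Proof. by move=> fh; apply: (aeS fh) => x; rewrite distrC. Qed.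

Lemma dominated_near p f h : m_nbhd mu I f p h -> dominated p f -> dominated p h.
Proof.
move=> fh [l fl]; exists (l + 1); apply: (aeS2 fh fl) => x fhx flx.
rewrite -[h x](subrK (f x)) mulrDl mul1r [leRHS]addrC.
by apply: le_trans (ler_normD _ _) (lerD _ flx); exact: ltW.
Qed.

(** The set and its complement are both stable under moves smaller than p, by
    [dominated_near] and the symmetry of that relation. *)
Lemma clopen_dominated p : Upos mu I p -> clopen (dominated p : set M).
Proof.
move=> Up; split; last rewrite -openC.
  rewrite openE => f fp; apply/m_nbhsP; exists p => // h fh.
  exact: dominated_near fp.
rewrite openE => f fp; apply/m_nbhsP; exists p => // h /m_nbhd_sym fh hp.
by apply: fp; exact: dominated_near hp.
Qed.

Lemma connected_dominated (V : set M) p : connected V -> V 0 -> Upos mu I p ->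
  V `<=` dominated p.
Proof.
move=> cV V0 Up; have [op cp] := clopen_dominated Up.
suff <- : V `&` (dominated p : set M) = V by move=> h [].
apply: cV; [|by exists (dominated p)|by exists (dominated p)].
exists 0; split => //; exists 0; apply: off_null_setT => x.
by rewrite mul0r -[X in `|X|]/(0 : R) normr0.
Qed.

End near_zero_sets.

(** A is the union of the segments joining f to its points, and segments are
    continuous images of [0, 1]. *)
Lemma star_connected (R : realType) (V : preTopologicalLmodType R) (A : set V)
    (f : V) : is_tvs V -> A f ->
  (forall g (t : R), A g -> 0 <= t <= 1 -> A (f + t *: (g - f))) ->
  connected A.
Proof.
move=> [addc scalec] Af star.
pose seg g (t : R^o) := f + t *: (g - f).
have -> : A = \bigcup_(g in A) (seg g @` `[0, 1]).
  apply/seteqP; split=> [g Ag|_ [g Ag [t t01 <-]]]; last first.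
    by apply: star => //; move: t01; rewrite /= in_itv.
  exists g => //; exists 1; first by rewrite /= in_itv/= ler01 lexx.
  by rewrite /seg scale1r addrC subrK.
apply: bigcup_connected => [|g _].
  exists f => g _; exists 0; first by rewrite /= in_itv/= ler01 lexx.
  by rewrite /seg scale0r addr0.
apply: connected_continuous_connected.
  exact/connected_intervalP/interval_is_interval.
apply: continuous_subspaceT => t.
apply: (@continuous_comp _ _ _ (fun t : R^o => (f, t *: (g - f)))
  (fun z : V * V => z.1 + z.2)); last exact: addc.
apply: cvg_pair; first exact: cvg_cst.
apply: (@continuous_comp _ _ _ (fun t : R^o => (t, g - f))
  (fun z : R^o * V => z.1 *: z.2)); last exact: scalec.
apply: (@cvg_pair _ _ _ (nbhs t) (nbhs (t : R^o)) (nbhs (g - f)) _ _ _ id (fun=> g - f)).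
  exact: cvg_id.
exact: cvg_cst.
Qed.

(** * Comparison of the topologies, and connectedness *)

Section topologies.
Context {d : measure_display} {T : measurableType d} {R : realType}.
Variables (mu : {measure set T -> \bar R}) (I : ideal {mfun T >-> R}).

(** Balls are taken with an eventual non-strict bound by e, which avoids the
    infimum defining the pseudonorm. *)
Lemma Linfty_space_nbhsP (f : Linfty_space mu I) (U : set (Linfty_space mu I)) :
  nbhs f U <-> exists2 e : R, 0 < e &
    forall g : Linfty_space mu I, conull mu I [set x | `|val g x - val f x| <= e] -> U g.
Proof.
split=> [/nbhs_ballP[e /= e0 eU]|[e e0 eU]].
  exists (e / 2) => [|g fg]; first exact: divr_gt0.
  apply: eU; apply/Linfty_normP; first by apply: LinftyB; exact: set_valP.
  exists (e / 2); last by rewrite ltr_pdivrMr// ltr_pMr// ltr1n.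
  split; first exact: divr_gt0.
  by apply: off_null_impl fg => x; rewrite distrC.
apply/nbhs_ballP; exists e => // g /Linfty_normP.
move=> /(_ (LinftyB (set_valP f) (set_valP g)))[l [_ fg] le]; apply: eU.
by apply: off_null_impl fg => x; rewrite distrC => /le_trans; apply; exact: ltW.
Qed.

Lemma Linfty_subspace_nbhsP (f : Linfty_subspace mu I)
    (U : set (Linfty_subspace mu I)) :
  nbhs f U <-> exists2 u, Upos mu I u &
    forall g : Linfty_subspace mu I, m_nbhd mu I (val f) u (val g) -> U g.
Proof.
split=> [|[u Uu uU]].
  rewrite nbhsE => -[_ [[W oW <-] Wf WU]].
  have /m_nbhsP[u Uu uW] := open_nbhs_nbhs (conj oW Wf).
  by exists u => // g /uW /WU.
rewrite nbhsE; exists (val @^-1` (m_nbhd mu I (val f) u)) => //; split.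
  by exists (m_nbhd mu I (val f) u) => //; exact: open_m_nbhd.
exact: m_nbhd_refl.
Qed.

Lemma Linfty_cst (r : R) : Linfty mu I (cst r).
Proof. by apply/LinftyE; exists `|r|; apply: off_null_setT => x; rewrite mulr1. Qed.

(** Constant functions are the test points for (3): if a pseudonorm ball of
    radius e about 0 is included in m(0, u), it contains the constant e, whence
    e < u eventually. *)
Lemma topology_Linfty : Linfty mu I = setT <->
  topology_of (Linfty_space mu I) = topology_of (Linfty_subspace mu I).
Proof.
rewrite Linfty_setT_Upos; split=> [ULB|top u Uu].
  rewrite /topology_of !openE; apply/seteqP; split=> U UU f /UU.
    move=> /Linfty_space_nbhsP[e e0 eU]; apply/Linfty_subspace_nbhsP.
    exists (cst e); first exact: off_null_setT.
    by move=> g fg; apply: eU; apply: off_null_impl fg => x; exact: ltW.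
  move=> /Linfty_subspace_nbhsP[u Uu uU]; apply/Linfty_space_nbhsP.
  have [e e0 ue] := ULB u Uu; exists (e / 2); first exact: divr_gt0.
  move=> g fg; apply: uU; apply: off_null_impl2 fg ue => x /le_lt_trans + eu.
  by apply; apply: lt_le_trans eu; rewrite ltr_pdivrMr// ltr_pMr// ltr1n.
pose c r : Linfty_subspace mu I := SigSub (mem_set (Linfty_cst r)).
have : nbhs (c 0) [set g : Linfty_subspace mu I | m_nbhd mu I (val (c 0)) u (val g)].
  by apply/Linfty_subspace_nbhsP; exists u.
rewrite nbhsE => -[B [oB B0 Bu]].
have {}oB : open (B : set (Linfty_space mu I)).
  by have : topology_of (Linfty_subspace mu I) B by []; rewrite -top.
have /Linfty_space_nbhsP[e e0 eB] := open_nbhs_nbhs (conj oB B0).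
exists e => //; have /eB/Bu : conull mu I [set x | `|val (c e) x - val (c 0) x| <= e].
  by apply: off_null_setT => x; rewrite /= subr0 gtr0_norm.
by apply: off_null_impl => x; rewrite /= subr0 gtr0_norm// => /ltW.
Qed.

Lemma connected_m_space : Linfty mu I = setT <-> connected [set: m_space mu I].
Proof.
have U1 : Upos mu I 1 by apply: off_null_setT => x; exact: ltr01.
split=> [/is_tvs_m_space tvs|cM]; first by apply: (@star_connected _ _ _ 0).
apply/seteqP; split=> // f _; apply/LinftyE.
exact: (connected_dominated cM).
Qed.

Lemma locally_connected_m_space :
  Linfty mu I = setT <-> locally_connected (m_space mu I).
Proof.
have U1 : Upos mu I 1 by apply: off_null_setT => x; exact: ltr01.
split=> [/is_tvs_m_space tvs f U /m_nbhsP[u Uu uU]|lc].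
  exists (m_nbhd mu I f u); split => //.
  - exact: open_m_nbhd.
  - exact: m_nbhd_refl.
  - apply: (star_connected tvs (f := f)); first exact: m_nbhd_refl.
    move=> g t fg /andP[t0 t1]; apply: off_null_impl fg => x.
    apply: le_lt_trans.
    rewrite -[X in `|X|]/(f x + t * (g x - f x) - f x) addrAC subrr add0r.
    by rewrite normrM ger0_norm// ler_piMl.
apply/seteqP; split=> // f _; apply/LinftyE.
have [V [oV V0 cV _]] := lc 0 setT filterT.
have /m_nbhsP[u Uu uV] := open_nbhs_nbhs (conj oV V0).
have [p Up pE] := mfun_div f Uu.
(* V contains u / 2 and is included in dominated p, which gives a bound of the
   form p (1 + |f|) / 2 <= l p *)
pose v : {mfun T >-> R} := 2^-1 *: u.
have : V v.
  apply: uV; apply: off_null_impl Uu => x ux.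
  rewrite -[X in `|X|]/(2^-1 * u x - 0) subr0 mulrC gtr0_norm ?divr_gt0//.
  by rewrite ltr_pdivrMr// ltr_pMr// ltr1n.
move=> /(connected_dominated cV V0 Up)[l vl].
exists (2 * l); apply: off_null_impl2 vl Up => x.
rewrite -[X in `|X|]/(2^-1 * u x) -pE => vx px.
have w0 : 0 < 1 + `|f x| by rewrite ltr_pwDl.
move: vx; rewrite mulrC gtr0_norm ?divr_gt0 ?mulr_gt0// ler_pdivrMr//.
rewrite mulrAC [l * 2]mulrC [p x * _]mulrC ler_pM2r//.
by rewrite mulr1; apply: le_trans; rewrite lerDr.
Qed.

Lemma mu_stableE : Linfty mu I = setT <-> mu_stable mu (zero_sets I).
Proof.
split=> [LT f|st].
  apply/holds_off_null_bounded; have [l [_ fl]] : Linfty mu I f by rewrite LT.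
  by exists l.
apply/seteqP; split=> // f _; have /holds_off_null_bounded[l fl] := st f.
by apply/LinftyE; exists l; apply: off_null_impl fl => x; rewrite mulr1.
Qed.

Lemma Imu_setT : mu_stable mu (zero_sets I) <-> Imu mu I = setT.
Proof.
split=> [st|IT f].
  by apply/seteqP; split=> // f _ g; exact: (st (f * g)).
have /(_ 1) : Imu mu I f by rewrite IT.
move=> /(holds_off_null_bounded mu I (f * 1)).1; rewrite mulr1.
by move=> ?; apply/holds_off_null_bounded.
Qed.

End topologies.

Theorem theorem2p7 (d : measure_display) (T : measurableType d) (R : realType)
    (mu : {measure set T -> \bar R}) (I : ideal {mfun T >-> R}) :
  [<-> Linfty mu I = [set: {mfun T >-> R}];
       Imu mu I = [set: {mfun T >-> R}];
       topology_of (Linfty_space mu I) = topology_of (Linfty_subspace mu I);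
       connected [set: m_space mu I];
       locally_connected (m_space mu I);
       mu_stable mu (zero_sets I);
       is_tvs (m_space mu I)].
Proof.
tfae.
- by move=> /mu_stableE /Imu_setT.
- by move=> /Imu_setT /mu_stableE /topology_Linfty.
- by move=> /topology_Linfty /connected_m_space.
- by move=> /connected_m_space /locally_connected_m_space.
- by move=> /locally_connected_m_space /mu_stableE.
- by move=> /mu_stableE /is_tvs_m_space.
- by move=> /is_tvs_m_space.
Qed.
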